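(* Let $\delta\in[0,1]$, $1\le q<\infty$ and $1\le p\le\infty$ with $p\ge 1+(q-1)(1-2\delta)^2$ be fixed. Then $$\|S_\delta\|_{p\to q}=O(\sqrt n),\qquad n\to\infty .$$
   Context: For $f:\mathbb{F}_2^n\to\mathbb{C}$ and $1\le p\le\infty$, $\|f\|_p=\left(\mathbb{E}|f(X)|^p\right)^{1/p}$ with $X$ uniform on $\mathbb{F}_2^n$ (for $p=\infty$, the maximum of $|f|$). For a linear operator $T$ on the space of functions $\mathbb{F}_2^n\to\mathbb{C}$, $\|T\|_{p\to q}=\sup_{f\ne0}\|Tf\|_q/\|f\|_p$. $|x|$ denotes the Hamming weight (number of ones) of $x\in\mathbb{F}_2^n$. For $\delta\in[0,1]$ the operator $S_\delta$ (depending on $n$) is $$S_\delta f(x)=\binom{n}{j}^{-1}\sum_{y\in\mathbb{F}_2^n,\ |y|=j}f(x+y),$$ where $j=\lceil\delta n\rceil$ if $\delta<1/2$ and $j=\lfloor\delta n\rfloor$ if $\delta\ge1/2$. *)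

(* Defs.v *)
From mathcomp Require Import all_boot all_order all_algebra.
From mathcomp Require Import complex.
From mathcomp Require Import all_classical all_reals all_analysis.

Set Implicit Arguments.
Unset Strict Implicit.
Unset Printing Implicit Defensive.

Import Order.TTheory GRing.Theory Num.Theory.
Local Open Scope classical_set_scope.
Local Open Scope ring_scope.
Local Open Scope complex_scope.

Notation cube n := 'rV['F_2]_n.

Definition hamming (n : nat) (x : cube n) : nat := #|[set i | x 0%R i != 0%R]%SET|.

Definition mean (R : realType) (n : nat) (g : cube n -> R) : R :=
  (\sum_x g x) / #|{: cube n}|%:R.

(* The value at p = -oo is a dummy: only exponents 1 <= p <= +oo are meant.
   [Normc.normc] is the complex modulus as an element of R
   (the ring norm `|z| on R[i] takes its values in R[i]). *)
Definition lpnorm (R : realType) (n : nat) (p : \bar R)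
    (f : {ffun cube n -> R[i]}) : R :=
  match p with
  | r%:E => mean (fun x => Normc.normc (f x) `^ r) `^ r^-1
  | +oo%E => \big[Num.max/0]_x Normc.normc (f x)
  | -oo%E => 0
  end.

Definition opnorm (R : realType) (n : nat) (p q : \bar R)
    (T : {ffun cube n -> R[i]} -> {ffun cube n -> R[i]}) : \bar R :=
  ereal_sup [set (lpnorm q (T f) / lpnorm p f)%:E | f in [set f | f != 0]].

(* For 0 <= delta both integers below are nonnegative, so [absz] only changes
   their type. *)
Definition radius (R : realType) (delta : R) (n : nat) : nat :=
  if delta < 2^-1 then `|Num.ceil (delta * n%:R)|%N
  else `|Num.floor (delta * n%:R)|%N.

Definition sphere_op (R : realType) (delta : R) (n : nat)
    (f : {ffun cube n -> R[i]}) : {ffun cube n -> R[i]} :=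
  [ffun x => ('C(n, radius delta n)%:R)^-1 *
     \sum_(y : cube n | hamming y == radius delta n) f (x + y)].

(* Main.v *)
Require Import Defs.
From mathcomp Require Import all_boot all_order all_algebra.
From mathcomp Require Import complex ring lra zify.
From mathcomp Require Import all_classical all_reals all_analysis.
Set Implicit Arguments.
Unset Strict Implicit.
Unset Printing Implicit Defensive.
Import Order.TTheory GRing.Theory Num.Theory.
Local Open Scope classical_set_scope.
Local Open Scope ring_scope.

(* With T_e the noise operator flipping each coordinate independently with
   probability e, we have T_e = sum_k Pr[Bin(n, e) = k] S_k with S_k the
   average over the sphere of radius k.  Hence |S_j f| is at most
   T_e |f| / Pr[Bin(n, e) = j] pointwise; for e = j / n this probability is at
   least 1 / (2 sqrt n), and T_e is a contraction from L^p to L^q as soon as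
   p >= 1 + (q - 1) (1 - 2 e)^2 (Bonami).

   Bonami's theorem tensorises in its bilinear form
     E[T_e(F^(1/p)) G^(1/q')] <= (E F)^(1/p) (E G)^(1/q'),
   which reduces it to two points.  There, with rho = 1 - 2 e, P = p - 1,
   Q = q - 1 and P = Q rho^2, put
     N_p(y) = (1 + y)^p + (1 - y)^p.
   The function ln(N_p(y) / 2) / p - ln(N_q(rho y) / 2) / q vanishes at 0, and it
   is nondecreasing exactly when rho w_Q(rho y) <= w_P(y), where
   w_k(y) = tanh(k artanh y).  Since Q rho = P / rho, the derivative of
   artanh(w_P(y) / rho) - Q artanh(rho y) is nonnegative by
   w^2 y^2 (1 + rho^-2) <= y^2 + w^2 rho^-2, valid for y, w in [0, 1]. *)

(** * Calculus *)

Lemma le_of_derive_ge0 (R : realType) (f df : R -> R) (b : R) :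
  0 <= b -> (forall x, 0 <= x <= b -> is_derive x 1 f (df x)) ->
  (forall x, 0 <= x <= b -> 0 <= df x) -> f 0 <= f b.
Proof.
rewrite le_eqVlt => /predU1P[<- //|b0] fd df0.
have [c| |c cb] := @MVT R f df 0 b b0.
- by rewrite in_itv /= => /andP[/ltW ? /ltW ?]; apply: fd; apply/andP.
- apply: derivable_within_continuous => x; rewrite in_itv /= => xb.
  by have := fd _ xb => -[].
rewrite subr0 -subr_ge0 => ->; rewrite mulr_ge0 // ?(ltW b0) //; apply: df0.
by move: cb; rewrite in_itv /= => /andP[/ltW -> /ltW ->].
Qed.

Lemma is_derive_powR1D (R : realType) (k c y : R) : 0 < 1 + c * y ->
  is_derive y 1 (fun t => (1 + c * t) `^ k)
    (k * c * (1 + c * y) `^ k / (1 + c * y)).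
Proof.
move=> h.
have h1 : is_derive y 1 (fun t : R => 1 + c * t) c.
  by apply: is_derive_eq; rewrite /GRing.scale /=; ring.
have hk := is_derive1_powR k h.
have := @is_derive1_comp _ (fun u => u `^ k) (fun t => 1 + c * t) _ _ _ hk h1.
move/is_derive_eq; apply.
rewrite powRB ?powRr1 ?(ltW h) ?(gt_eqF h) ?implybT //; ring.
Qed.


Lemma is_derive_ln_comp (R : realType) (g : R -> R) (dg y : R) :
  is_derive y 1 g dg -> 0 < g y -> is_derive y 1 (fun t => ln (g t)) (dg / g y).
Proof.
move=> gd h; have hk := is_derive1_ln h.
have := @is_derive1_comp _ (@ln R) g _ _ _ hk gd.
by move/is_derive_eq; apply; rewrite mulrC.
Qed.

(** The auxiliary functions below keep coefficients such as [1] and [-1] explicit so that this one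
    rule differentiates them. *)
Lemma is_derive_lincomb (R : realType) (f g : R -> R) (df dg a b y : R) :
  is_derive y 1 f df -> is_derive y 1 g dg ->
  is_derive y 1 (fun t => a * f t + b * g t) (a * df + b * dg).
Proof. by move=> fd gd; apply: is_derive_eq; rewrite /GRing.scale /=; ring. Qed.

(** * The two-point inequality *)

(* [rho w_Q(rho y) <= w_P(y)] with denominators cleared. *)
Lemma powR_pair_ratio (R : realType) (P Q rho y : R) :
  0 < P -> 0 < rho <= 1 -> Q * rho ^+ 2 = P -> 0 <= y < 1 ->
  let A := (1 + y) `^ P in let B := (1 - y) `^ P in
  let A' := (1 + rho * y) `^ Q in let B' := (1 - rho * y) `^ Q in
  rho * (A' - B') * (A + B) <= (A - B) * (A' + B').
Proof.
move=> P0 /andP[r0 r1] QP /andP[y0 y1].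
(* With w = (A - B) / (A + B), [g 1] and [g (-1)] are A + B times rho + w and rho - w, so the claim
   becomes [g (-1) y * A' <= g 1 y * B']. *)
pose A c t : R := (1 + c * t) `^ P.
pose g c t := (rho - c) * A (-1) t + (rho + c) * A 1 t.
have pos c t : -1 <= c <= 1 -> 0 <= t <= y -> 0 < 1 + c * t by move=> *; nra.
have A0 c t : -1 <= c <= 1 -> 0 <= t <= y -> 0 < A c t.
  by move=> *; apply/powR_gt0/pos.
have Q0 : 0 < Q by rewrite -(pmulr_lgt0 _ (exprn_gt0 2 r0)) QP.
(* Logarithms require [g (-1) y] positive; otherwise the left side is at most 0 and the right side
   is nonnegative. *)
suff main : 0 < g (-1) y ->
    g (-1) y * (1 + rho * y) `^ Q <= g 1 y * (1 - rho * y) `^ Q.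
  set a := _ `^ _; set b := _ `^ _; set a' := _ `^ _; set b' := _ `^ _; move=> /=.
  have a'0 : 0 <= a' by exact: powR_ge0.
  have b'0 : 0 <= b' by exact: powR_ge0.
  suff : g (-1) y * a' <= g 1 y * b'.
    by rewrite /g /A !mulN1r !mul1r -/a -/b; nra.
  case: (ltP 0 (g (-1) y)) => [/main //|gN].
  apply: (@le_trans _ _ 0); first by rewrite mulr_le0_ge0.
  rewrite mulr_ge0 // /g.
  have Ay : A (-1) y <= A 1 y.
    rewrite /A ge0_ler_powR ?nnegrE ?(ltW P0) //; try (apply/ltW/pos; lra).
    by lra.
  by have := A0 (-1) y; nra.
move=> gy.
have Adec t : 0 <= t <= y -> A (-1) y <= A (-1) t.
  by move=> ty; rewrite /A ge0_ler_powR ?nnegrE ?(ltW P0) //; try (apply/ltW/pos; lra); lra.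
have Ainc t : 0 <= t <= y -> A 1 t <= A 1 y.
  by move=> ty; rewrite /A ge0_ler_powR ?nnegrE ?(ltW P0) //; try (apply/ltW/pos; lra); lra.
(* [g (-1)] is nonincreasing because rho <= 1, so its positivity at y extends to [0, y]. *)
have g0 t : 0 <= t <= y -> 0 < g (-1) t.
  move=> ty; apply: lt_le_trans gy _; rewrite /g.
  have := Adec t ty; have := Ainc t ty; nra.
have g1 t : 0 <= t <= y -> 0 < g 1 t.
  move=> ty; apply: lt_le_trans (g0 t ty) _; rewrite /g.
  have : A (-1) t <= A 1 t; last by lra.
  by rewrite /A ge0_ler_powR ?nnegrE ?(ltW P0) //; try (apply/ltW/pos; lra); lra.
(* [H t] is twice artanh(w_P(t) / rho) - Q artanh(rho t). *)
pose H t := 1 * (1 * ln (g 1 t) + (-1) * ln (g (-1) t)) +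
   (- Q) * (1 * ln (1 + rho * t) + (-1) * ln (1 + (- rho) * t)).
pose dA c t : R := P * c * A c t / (1 + c * t).
pose dg c t := (rho - c) * dA (-1) t + (rho + c) * dA 1 t.
pose dH t := 1 * (1 * (dg 1 t / g 1 t) + (-1) * (dg (-1) t / g (-1) t)) +
  (- Q) * (1 * (rho / (1 + rho * t)) + (-1) * ((- rho) / (1 + (- rho) * t))).
have HH : H 0 <= H y.
  apply: (@le_of_derive_ge0 _ H dH) => // t ty.
    have dgP c : is_derive t 1 (g c) (dg c t).
      by apply: is_derive_lincomb; apply: is_derive_powR1D; apply: pos => //; lra.
    have dlP c : is_derive t 1 (fun x : R => 1 + c * x) c.
      by apply: is_derive_eq; rewrite /GRing.scale /=; ring.
    have dgl c : 0 < g c t -> is_derive t 1 (fun x => ln (g c x)) (dg c t / g c t).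
      exact: is_derive_ln_comp.
    have dll c : -1 <= c <= 1 ->
        is_derive t 1 (fun x : R => ln (1 + c * x)) (c / (1 + c * t)).
      by move=> ?; apply: is_derive_ln_comp => //; exact: pos.
    apply: is_derive_lincomb; apply: is_derive_lincomb.
    - exact/dgl/g1.
    - exact/dgl/g0.
    - by apply: dll; lra.
    - by apply: dll; lra.
  have d0 c := @pos c t.
  (* With a = [A 1 t], b = [A (-1) t] and w = (a - b) / (a + b), the bracket is (a + b)^2 (w^2 (1 -
     t^2) + rho^2 t^2 (1 - w^2)), a sum of nonnegative terms. The relation Q rho^2 = P is what makes
     1 - rho^2 factor out. *)
  have -> : dH t = 2 * P * (1 - rho ^+ 2) *
     ((A 1 t - A (-1) t) ^+ 2 * (1 - t ^+ 2) + 4 * rho ^+ 2 * t ^+ 2 * A 1 t * A (-1) t) /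
     (rho * g 1 t * g (-1) t * (1 - t) * (1 + t) * (1 - rho * t) * (1 + rho * t)).
    have := g0 t ty; have := g1 t ty.
    rewrite /dH /dg /dA -QP.
    rewrite /g; move: (A 1 t) (A (-1) t) => a b h1 h2.
    field.
    have t1 := pos 1 t; have tN1 := pos (-1) t.
    have tr := pos rho t; have tNr := pos (- rho) t.
    by repeat (apply/andP; split); apply: lt0r_neq0; lra.
  have t1 : 0 < 1 - t by lra.
  have tr : 0 < 1 - rho * t by have := pos (- rho) t; lra.
  have at0 : 0 < A 1 t by apply: A0 => //; lra.
  have bt0 : 0 < A (-1) t by apply: A0 => //; lra.
  have := g0 t ty; have := g1 t ty => g1t g0t.
  apply: mulr_ge0; last first.
    by rewrite invr_ge0 !mulr_ge0 // ?(ltW r0) ?(ltW t1) ?(ltW tr) ?(ltW g0t) ?(ltW g1t) //; nra.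
  have rr : 0 <= 1 - rho ^+ 2 by nra.
  have tt : 0 <= 1 - t ^+ 2 by nra.
  apply: mulr_ge0; first by rewrite !mulr_ge0 // ltW.
  apply: addr_ge0; first exact: mulr_ge0 (sqr_ge0 _) tt.
  do 2 (apply: mulr_ge0; last exact: ltW).
  apply: mulr_ge0; last exact: sqr_ge0.
  apply: mulr_ge0; last exact: sqr_ge0.
  exact: ler0n.
have y1' : 0 < 1 + rho * y by nra.
have y2' : 0 < 1 - rho * y by nra.
have gy1 : 0 < g 1 y by apply: g1; lra.
rewrite -ler_ln ?posrE ?mulr_gt0 ?powR_gt0 // !lnM ?posrE ?powR_gt0 // !ln_powR.
suff H0 : H 0 = 0 by move: HH; rewrite H0 /H !mulNr; lra.
rewrite /H /g /A !mulr0 !addr0 ln1 powR1 !mulr1.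
have -> : rho - -1 + (rho + -1) = rho - 1 + (rho + 1) by ring.
by ring.
Qed.

(** * Power means, i.e. L^r norms on the uniform two-point space *)

Definition pmean2 (R : realType) (r a b : R) : R :=
  ((a `^ r + b `^ r) / 2) `^ r^-1.

Lemma pmean2C (R : realType) (r a b : R) : pmean2 r a b = pmean2 r b a.
Proof. by rewrite /pmean2 addrC. Qed.

Lemma pmean2_ge0 (R : realType) (r a b : R) : 0 <= pmean2 r a b.
Proof. exact: powR_ge0. Qed.

Lemma powR_sum2_ge0 (R : realType) (r a b : R) : 0 <= (a `^ r + b `^ r) / 2.
Proof. by rewrite divr_ge0 // addr_ge0 ?powR_ge0. Qed.

Lemma le_pmean2 (R : realType) (r a b a' b' : R) : 0 < r ->
  0 <= a <= a' -> 0 <= b <= b' -> pmean2 r a b <= pmean2 r a' b'.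
Proof.
move=> r0 /andP[a0 aa] /andP[b0 bb].
rewrite /pmean2 ge0_ler_powR ?nnegrE ?powR_sum2_ge0 ?invr_ge0 ?(ltW r0) //.
rewrite ler_pM2r ?invr_gt0 // lerD // ge0_ler_powR ?nnegrE ?(ltW r0) //.
  exact: le_trans aa.
exact: le_trans bb.
Qed.

Lemma pmean2Z (R : realType) (r s a b : R) : 0 < r -> 0 <= s -> 0 <= a -> 0 <= b ->
  pmean2 r (s * a) (s * b) = s * pmean2 r a b.
Proof.
move=> r0 s0 a0 b0; rewrite /pmean2 (powRM _ s0 a0) (powRM _ s0 b0) -mulrDr -mulrA.
by rewrite powRM ?powR_ge0 ?powR_sum2_ge0 // -powRrM divff ?gt_eqF // powRr1.
Qed.

Lemma pmean2xx (R : realType) (r a : R) : 0 < r -> 0 <= a -> pmean2 r a a = a.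
Proof.
move=> r0 a0; rewrite /pmean2 -[X in X / 2]mulr2n -[X in X / 2]mulr_natr mulfK ?pnatr_eq0 //.
by rewrite -powRrM divff ?gt_eqF // powRr1.
Qed.

Lemma pmean2_1 (R : realType) (a b : R) : 0 <= a -> 0 <= b -> pmean2 1 a b = (a + b) / 2.
Proof. by move=> a0 b0; rewrite /pmean2 invr1 !powRr1 // divr_ge0 // addr_ge0. Qed.

(** After division by 2 both arguments on the left lie in [0, 1] and sum to 1, and there x^p <= x.
    This gives a bound uniform in t for the limit t -> 1. *)
Lemma pmean2_20 (R : realType) (p t : R) : 1 <= p -> 0 <= t < 1 ->
  pmean2 p (1 + t) (1 - t) <= pmean2 p 2 0.
Proof.
move=> p1 t01; have p0 : 0 < p by lra.
have -> : 1 + t = 2 * ((1 + t) / 2) by field.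
have -> : 1 - t = 2 * ((1 - t) / 2) by field.
rewrite -[X in _ <= pmean2 p X _]mulr1 -[X in _ <= pmean2 p _ X](mulr0 2).
have t1 : 0 <= (1 + t) / 2 by lra.
have t2 : 0 <= (1 - t) / 2 by lra.
rewrite (pmean2Z p0 (ler0n R 2) t1 t2) (pmean2Z p0 (ler0n R 2) ler01 (lexx 0)).
rewrite (ler_pM2l (ltr0n R 2)).
rewrite /pmean2 ge0_ler_powR ?nnegrE ?powR_sum2_ge0 ?invr_ge0 ?(ltW p0) //.
rewrite ler_pM2r ?invr_gt0 // powR1 powR0 ?gt_eqF // addr0.
have h1 : ((1 + t) / 2) `^ p <= (1 + t) / 2 by apply: ge1r_powR => //; lra.
have h2 : ((1 - t) / 2) `^ p <= (1 - t) / 2 by apply: ge1r_powR => //; lra.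
lra.
Qed.

Lemma ln_pmean2 (R : realType) (r a b : R) : 0 < a -> 0 < b ->
  ln (pmean2 r a b) = r^-1 * (ln (a `^ r + b `^ r) - ln 2).
Proof.
move=> a0 b0; rewrite /pmean2 ln_powR; congr (_ * _).
by apply: ln_div; rewrite posrE //; apply: addr_gt0; apply: powR_gt0.
Qed.

Lemma le_from_ln (R : realType) (x y u v : R) :
  0 < x -> 0 < y -> ln x = u -> ln y = v -> u <= v -> x <= y.
Proof. by move=> x0 y0 <- <-; rewrite ler_ln ?posrE. Qed.

(** Taking logarithms and multiplying by r s leaves a condition free of inverses, convenient for
    differentiation. *)
Lemma le_pmean2_ln (R : realType) (r s a b c d : R) : 0 < r -> 0 < s ->
  0 < a -> 0 < b -> 0 < c -> 0 < d ->
  (r - s) * ln 2 <= r * ln (c `^ s + d `^ s) - s * ln (a `^ r + b `^ r) ->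
  pmean2 r a b <= pmean2 s c d.
Proof.
move=> r0 s0 a0 b0 c0 d0 H.
have pos (k x y : R) : 0 < x -> 0 < y -> 0 < pmean2 k x y.
  move=> x0 y0; apply/powR_gt0/divr_gt0; last exact: ltr0n.
  by apply: addr_gt0; apply: powR_gt0.
apply: (le_from_ln (pos r a b a0 b0) (pos s c d c0 d0)
  (ln_pmean2 r a0 b0) (ln_pmean2 s c0 d0)).
rewrite ler_pdivrMl // mulrCA ler_pdivlMl //; move: H.
move: (ln (c `^ s + _)) (ln (a `^ r + _)) (ln 2) => u v l.
by clear - r s; lra.
Qed.

Lemma two_point_lt (R : realType) (P Q rho y : R) :
  0 < P -> 0 < rho <= 1 -> Q * rho ^+ 2 = P -> 0 <= y < 1 ->
  pmean2 (1 + Q) (1 + rho * y) (1 - rho * y) <= pmean2 (1 + P) (1 + y) (1 - y).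
Proof.
move=> P0 /andP[r0 r1] QP /andP[y0 y1].
have Q0 : 0 < Q by rewrite -(pmulr_lgt0 _ (exprn_gt0 2 r0)) QP.
pose A k c t : R := (1 + c * t) `^ k.
pose S k c t : R := 1 * A k c t + 1 * A k (- c) t.
have pos c t : -1 <= c <= 1 -> 0 <= t <= y -> 0 < 1 + c * t by move=> *; nra.
have A0 k c t : -1 <= c <= 1 -> 0 <= t <= y -> 0 < A k c t.
  by move=> *; apply/powR_gt0/pos.
have S0 k c t : -1 <= c <= 1 -> 0 <= t <= y -> 0 < S k c t.
  by move=> *; rewrite /S !mul1r addr_gt0 // A0 //; lra.
(* With p = 1 + P and q = 1 + Q, [F t - F 0] is p q times ln(N_p(t) / 2) / p - ln(N_q(rho t) / 2) /
   q. *)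
pose F t := (1 + Q) * ln (S (1 + P) 1 t) + - (1 + P) * ln (S (1 + Q) rho t).
pose dA k c t : R := k * c * A k c t / (1 + c * t).
pose dS k c t : R := 1 * dA k c t + 1 * dA k (- c) t.
pose dF t := (1 + Q) * (dS (1 + P) 1 t / S (1 + P) 1 t)
  + - (1 + P) * (dS (1 + Q) rho t / S (1 + Q) rho t).
have FF : F 0 <= F y.
  apply: (@le_of_derive_ge0 _ F dF) => [//|t ty|t ty].
    have SP k c : -1 <= c <= 1 -> is_derive t 1 (S k c) (dS k c t).
      by move=> ?; apply: is_derive_lincomb; apply: is_derive_powR1D; apply: pos => //; lra.
    by apply: is_derive_lincomb; apply: is_derive_ln_comp; (try apply: SP);
      (try apply: S0) => //; lra.
  have Ak k c : -1 <= c <= 1 -> A (1 + k) c t = (1 + c * t) * A k c t.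
    move=> c1; have ct := pos c t c1 ty.
    by rewrite /A powRD ?powRr1 ?(ltW ct) ?(gt_eqF ct) ?implybT.
  have dAk k c : -1 <= c <= 1 -> dA (1 + k) c t = (1 + k) * c * A k c t.
    move=> c1; have ct := pos c t c1 ty.
    by rewrite /dA Ak //; field; rewrite gt_eqF.
  have S1 : 0 < S (1 + P) 1 t by apply: S0 => //; lra.
  have S2 : 0 < S (1 + Q) rho t by apply: S0 => //; lra.
  have t01 : 0 <= t < 1 by lra.
  have r01 : 0 < rho <= 1 by lra.
  have := @powR_pair_ratio R P Q rho t P0 r01 QP t01.
  rewrite /dF.
  have -> : dS (1 + P) 1 t = (1 + P) * (A P 1 t - A P (-1) t).
    by rewrite /dS !dAk; [ring|lra|lra].
  have -> : dS (1 + Q) rho t = (1 + Q) * rho * (A Q rho t - A Q (- rho) t).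
    by rewrite /dS !dAk; [ring|lra|lra].
  move: S1 S2; rewrite /S !Ak; try lra.
  rewrite /A !mulN1r !mul1r !mulNr.
  set a := (1 + t) `^ P; set b := (1 - t) `^ P.
  set c := _ `^ Q; set d := (1 - rho * t) `^ Q => S1 S2 H.
  have -> : forall x y z w : R, (1 + Q) * ((1 + P) * x / z) +
      (- ((1 + P) * ((1 + Q) * rho * y / w))) =
      (1 + Q) * (1 + P) * (x / z - rho * y / w) by move=> *; ring.
  apply: mulr_ge0; first by rewrite mulr_ge0 //; lra.
  rewrite subr_ge0 ler_pdivrMr // mulrAC ler_pdivlMr //.
  (* The two sums are (a + b) + t (a - b) and (c + d) + rho t (c - d). The cross term rho t (a - b)
     (c - d) occurs on both sides and cancels, which leaves [H]. *)
  move: a b c d S1 S2 H => a b c d S1 S2 H; lra.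
have y1' : 0 < 1 + y by lra.
have y2' : 0 < 1 - y by lra.
have z1' : 0 < 1 + rho * y by nra.
have z2' : 0 < 1 - rho * y by nra.
have F0 : F 0 = (Q - P) * ln 2.
  by rewrite /F /S /A !mulr0 !addr0 powR1 !mulr1; ring.
move: FF; rewrite F0 /F /S /A !mul1r mulN1r mulNr.
clear pos A0 S0 dA dS dF => FF.
apply: le_pmean2_ln; [lra|lra|exact: z1'|exact: z2'|exact: y1'|exact: y2'|].
have -> : 1 + Q - (1 + P) = Q - P by ring.
by move: FF; rewrite mulNr.
Qed.

(** Write a = s (1 + y) and b = s (1 - y): the noise replaces y by rho y, and homogeneity removes
    s. *)
Lemma two_point (R : realType) (q delta a b : R) :
  1 <= q -> 0 <= delta <= 1 -> 0 <= a -> 0 <= b ->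
  pmean2 q ((1 - delta) * a + delta * b) (delta * a + (1 - delta) * b) <=
  pmean2 (1 + (q - 1) * (1 - 2 * delta) ^+ 2) a b.
Proof.
move=> q1.
wlog ba : a b / b <= a => [H|].
  have [ba|/ltW ab] := leP b a; first exact: H.
  move=> d01 a0 b0; have := H b a ab d01 b0 a0.
  by rewrite pmean2C (pmean2C _ b a) ![_ + _ * a]addrC.
(* Replacing delta by 1 - delta swaps the two values on the left and changes only the sign of
   rho. *)
wlog d2 : delta / delta <= 1 / 2 => [H|].
  have [d2|/ltW d2] := leP delta (1 / 2); first exact: H.
  move=> d01 a0 b0; have := H (1 - delta) _ _ a0 b0.
  have -> : 1 - 2 * (1 - delta) = - (1 - 2 * delta) by ring.
  by rewrite subKr sqrrN pmean2C; apply; lra.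
move=> d01 a0 b0; have q0 : 0 < q by lra.
have [Q0|Q0] := eqVneq q 1.
  by rewrite Q0 subrr mul0r addr0 !pmean2_1 //; nra.
(* Here P = 0: both values on the left equal the mean, and the exponent on the right is 1. *)
have [D0|D0] := eqVneq delta (1 / 2).
  have -> : 1 - 2 * delta = 0 by rewrite D0; field.
  rewrite expr0n mulr0 addr0 pmean2_1 // D0.
  have -> : (1 - 1 / 2) * a + 1 / 2 * b = (a + b) / 2 by field.
  have -> : 1 / 2 * a + (1 - 1 / 2) * b = (a + b) / 2 by field.
  by rewrite pmean2xx //; lra.
set rho := 1 - 2 * delta.
have r01 : 0 < rho <= 1 by rewrite /rho; move/eqP: D0 => D0; lra.
have Q1 : 0 < q - 1 by move/eqP: Q0 => Q0; lra.
set P := (q - 1) * rho ^+ 2.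
have P0 : 0 < P by rewrite /P; apply: mulr_gt0 => //; apply: exprn_gt0; lra.
pose s := (a + b) / 2.
have [s0|s0] := eqVneq (a + b) 0.
  have -> : a = 0 by lra.
  have -> : b = 0 by lra.
  by rewrite !mulr0 addr0 !pmean2xx //; lra.
have sp : 0 < s by rewrite /s; move/eqP: s0 => s0; lra.
pose y := (a - b) / (a + b).
have y0 : 0 <= y by rewrite /y divr_ge0 //; lra.
have y1 : y <= 1 by rewrite /y ler_pdivrMr /s in sp *; lra.
have -> : (1 - delta) * a + delta * b = s * (1 + rho * y).
  by rewrite /s /rho /y; field.
have -> : delta * a + (1 - delta) * b = s * (1 - rho * y).
  by rewrite /s /rho /y; field.
rewrite (_ : pmean2 _ a b = pmean2 (1 + P) (s * (1 + y)) (s * (1 - y))); last first.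
  by congr (pmean2 _ _ _); rewrite /s /y; field.
have P1 : 0 < 1 + P by lra.
have y2 : 0 <= 1 - y by lra.
have y3 : 0 <= 1 + y by lra.
have y4 : 0 <= 1 + rho * y by clear - r01 y0; nra.
have y5 : 0 <= 1 - rho * y by clear - r01 y0 y1; nra.
rewrite (pmean2Z q0 (ltW sp) y4 y5) (pmean2Z P1 (ltW sp) y3 y2).
apply: ler_wpM2l; first exact: ltW.
clear y2 y3 y4 y5 sp s0.
have lt t : 0 <= t < 1 ->
    pmean2 q (1 + rho * t) (1 - rho * t) <= pmean2 (1 + P) (1 + t) (1 - t).
  move=> t01; have -> : q = 1 + (q - 1) by lra.
  exact: two_point_lt.
have [y1'|y1'] := ltP y 1; first by apply: lt; lra.
have -> : y = 1 by lra.
rewrite mulr1 subrr.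
(* The case [y = 1] follows from [y < 1] because [t (1 + rho) <= 1 + rho t]
   and [t (1 - rho) <= 1 - rho t]. *)
have limt t : 0 <= t < 1 -> t * pmean2 q (1 + rho) (1 - rho) <= pmean2 (1 + P) (1 + 1) 0.
  move=> t01; have s1 : 0 <= 1 + rho by lra.
  have s2 : 0 <= 1 - rho by lra.
  have t0 : 0 <= t by lra.
  rewrite -(pmean2Z q0 t0 s1 s2).
  apply: le_trans (_ : pmean2 q (1 + rho * t) (1 - rho * t) <= _).
    by clear - q0 r01 t0 t01; apply: le_pmean2; [exact: q0|nra|nra].
  apply: le_trans (lt _ t01) _.
  by apply: pmean2_20 => //; lra.
rewrite leNgt; apply/negP.
move: limt; set X := pmean2 q _ _; set Y := pmean2 (1 + P) _ _ => limt YX.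
have Y0 : 0 <= Y by exact: pmean2_ge0.
have X0 : 0 < X by exact: le_lt_trans YX.
(* This t is below 1 and makes t X the midpoint of X and Y, which exceeds Y. *)
have := limt ((X + Y) / (2 * X)).
have -> : (X + Y) / (2 * X) * X = (X + Y) / 2 by field; lra.
have t01 : 0 <= (X + Y) / (2 * X) < 1.
  by rewrite divr_ge0 ?ltr_pdivrMr /=; lra.
by move/(_ t01); clear - YX; move: X Y YX => X Y YX; lra.
Qed.

(** * Tensorisation *)

Definition cube_cons n (s : 'F_2) (x : cube n) : cube n.+1 :=
  row_mx (const_mx s : 'rV_1) x.

Lemma cube_consD n (s t : 'F_2) (x y : cube n) :
  cube_cons s x + cube_cons t y = cube_cons (s + t) (x + y).
Proof.
rewrite /cube_cons.
have -> : const_mx (s + t) = const_mx s + const_mx t :> 'rV_1.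
  by apply/rowP => i; rewrite !mxE.
exact: (add_row_mx (const_mx s : 'rV_1) x (const_mx t) y).
Qed.

Lemma sum_F2 (V : nmodType) (g : 'F_2 -> V) : \sum_s g s = g 0 + g 1.
Proof.
rewrite (bigD1 0) //= (bigD1 1) //= big_pred0 ?addr0 //.
by case=> [[|[|]]].
Qed.

Lemma sum_cube_cons (V : nmodType) n (g : cube n.+1 -> V) :
  \sum_x g x = \sum_x g (cube_cons 0 x) + \sum_x g (cube_cons 1 x).
Proof.
rewrite -(sum_F2 (fun s => \sum_x g (cube_cons s x))) pair_big /=.
rewrite (reindex (fun u : 'F_2 * cube n => cube_cons u.1 u.2)) //=.
pose l := @lsubmx 'F_2 1 1 n; pose r := @rsubmx 'F_2 1 1 n.
exists (fun x => (l x 0 0, r x)) => [[s x] _|x _] /=.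
  rewrite /cube_cons /l /r (row_mxKl (const_mx s : 'rV_1)).
  by rewrite (row_mxKr (const_mx s : 'rV_1)) mxE.
rewrite -[RHS](@hsubmxK _ 1 1 n x) /cube_cons -/(l x) -/(r x).
suff -> : const_mx (l x 0 0) = l x by [].
by apply/rowP => i; rewrite [LHS]mxE (ord1 i).
Qed.

Lemma sum_cube0 (V : nmodType) (g : cube 0 -> V) : \sum_x g x = g 0.
Proof. by rewrite (big_pred1 0) // => x; rewrite [x]thinmx0 /= eqxx. Qed.

Lemma card_cubeS n : #|{: cube n.+1}| = (2 * #|{: cube n}|)%N.
Proof. by rewrite !card_mx card_Fp // !mul1n expnS. Qed.

Lemma mean_cons (R : realType) n (g : cube n.+1 -> R) :
  mean g = (mean (fun x => g (cube_cons 0 x)) + mean (fun x => g (cube_cons 1 x))) / 2.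
Proof.
rewrite /mean sum_cube_cons card_cubeS natrM.
have : #|{: cube n}|%:R != 0 :> R by rewrite pnatr_eq0 card_mx card_Fp // mul1n expn_eq0.
move: (#|{: cube n}|%:R : R) => N N0.
by field.
Qed.

Section mean_theory.
Variables (R : realType) (n : nat).
Implicit Types f g : cube n -> R.

Lemma mean_ge0 f : (forall x, 0 <= f x) -> 0 <= mean f.
Proof. by move=> f0; rewrite divr_ge0 // sumr_ge0. Qed.

Lemma le_mean f g : (forall x, f x <= g x) -> mean f <= mean g.
Proof. by move=> fg; rewrite ler_wpM2r ?invr_ge0 // ler_sum. Qed.

Lemma eq_mean f g : f =1 g -> mean f = mean g.
Proof. by move=> fg; congr (_ / _); apply: eq_bigr. Qed.

Lemma meanD f g : mean (fun x => f x + g x) = mean f + mean g.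
Proof. by rewrite /mean big_split mulrDl. Qed.

Lemma meanZ (c : R) f : mean (fun x => c * f x) = c * mean f.
Proof. by rewrite /mean -mulr_sumr mulrA. Qed.

Lemma mean_cst (c : R) : mean (fun _ : cube n => c) = c.
Proof.
rewrite /mean sumr_const -[c *+ _]mulr_natr mulfK // pnatr_eq0 card_mx card_Fp //.
by rewrite mul1n expn_eq0.
Qed.

End mean_theory.

(** * The noise operator and its hypercontractivity *)

Definition noise_weight (R : realType) (delta : R) n (z : cube n) : R :=
  \prod_i (if z 0 i == 0 then 1 - delta else delta).

Definition noise_op (R : realType) (delta : R) n (f : cube n -> R) (x : cube n) : R :=
  \sum_z noise_weight delta z * f (x + z).

Lemma noise_weight_ge0 (R : realType) (delta : R) n (z : cube n) :
  0 <= delta <= 1 -> 0 <= noise_weight delta z.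
Proof. by move=> d01; apply: prodr_ge0 => i _; case: ifP => _; lra. Qed.

Lemma noise_op_ge0 (R : realType) (delta : R) n (f : cube n -> R) x :
  0 <= delta <= 1 -> (forall y, 0 <= f y) -> 0 <= noise_op delta f x.
Proof. by move=> d01 f0; apply: sumr_ge0 => z _; rewrite mulr_ge0 // noise_weight_ge0. Qed.

Lemma noise_weight_cons (R : realType) (delta : R) n s (z : cube n) :
  noise_weight delta (cube_cons s z) =
  (if s == 0 then 1 - delta else delta) * noise_weight delta z.
Proof.
rewrite /noise_weight (@big_split_ord _ _ _ 1 n) /= big_ord_recl big_ord0 mulr1.
congr (_ * _).
  by rewrite /cube_cons (row_mxEl (const_mx s : 'rV_1)) mxE.
by apply: eq_bigr => i _; rewrite /cube_cons (row_mxEr (const_mx s : 'rV_1)).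
Qed.

Lemma noise_op_cons (R : realType) (delta : R) n (f : cube n.+1 -> R) s x :
  noise_op delta f (cube_cons s x) =
  (1 - delta) * noise_op delta (fun y => f (cube_cons s y)) x +
  delta * noise_op delta (fun y => f (cube_cons (s + 1) y)) x.
Proof.
rewrite /noise_op sum_cube_cons !mulr_sumr; congr (_ + _); apply: eq_bigr => z _;
  by rewrite cube_consD noise_weight_cons mulrA ?addr0.
Qed.

(** Induction on n, splitting off one coordinate. The induction hypothesis bounds each block by
    powers of the means of F and G over half-cubes, and the two-point inequality applied to these
    means recombines them. *)
Lemma noise_tensorization (R : realType) (delta a b : R) : 0 <= delta <= 1 ->
  (forall F0 F1 G0 G1 : R, 0 <= F0 -> 0 <= F1 -> 0 <= G0 -> 0 <= G1 ->
    (((1 - delta) * F0 `^ a + delta * F1 `^ a) * G0 `^ b +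
     (delta * F0 `^ a + (1 - delta) * F1 `^ a) * G1 `^ b) / 2 <=
    ((F0 + F1) / 2) `^ a * ((G0 + G1) / 2) `^ b) ->
  forall n (F G : cube n -> R), (forall x, 0 <= F x) -> (forall x, 0 <= G x) ->
  mean (fun x => noise_op delta (fun y => F y `^ a) x * G x `^ b) <=
  mean F `^ a * mean G `^ b.
Proof.
move=> d01 two; elim=> [|n IH] F G F0 G0.
  rewrite /mean !sum_cube0 card_mx muln0 expn0 !divr1 /noise_op sum_cube0 addr0.
  by rewrite /noise_weight big_ord0 mul1r.
pose Fs s x := F (cube_cons s x); pose Gs s x := G (cube_cons s x).
(* The block where F has first bit s and G has first bit t. *)
pose X s t := mean (fun x => noise_op delta (fun y => Fs s y `^ a) x * Gs t x `^ b).
have IHs s t : X s t <= mean (Fs s) `^ a * mean (Gs t) `^ b.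
  by apply: IH => x; rewrite ?/Fs ?/Gs.
have split s : mean (fun x => noise_op delta (fun y => F y `^ a) (cube_cons s x) *
    G (cube_cons s x) `^ b) = (1 - delta) * X s s + delta * X (s + 1) s.
  rewrite /X -!meanZ -meanD; apply: eq_mean => x.
  by rewrite noise_op_cons /Fs /Gs mulrDl !mulrA.
rewrite (mean_cons (fun x => _ * _)) !split (mean_cons F) (mean_cons G).
apply: le_trans (two _ _ _ _ _ _ _ _); try by apply: mean_ge0.
rewrite ler_pM2r ?invr_gt0 //.
have -> : (1 + 1 : 'F_2) = 0 by apply/val_inj.
rewrite add0r.
have d0 : 0 <= delta by lra.
have d1 : 0 <= 1 - delta by lra.
have := ler_wpM2l d1 (IHs 0 0); have := ler_wpM2l d0 (IHs 1 0).
have := ler_wpM2l d0 (IHs 0 1); have := ler_wpM2l d1 (IHs 1 1).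
rewrite -/(Fs 0) -/(Fs 1) -/(Gs 0) -/(Gs 1).
move: (X 0 0) (X 0 1) (X 1 0) (X 1 1) => x00 x01 x10 x11.
move: (mean (Fs 0) `^ a) (mean (Fs 1) `^ a) (mean (Gs 0) `^ b) (mean (Gs 1) `^ b).
move=> f0 f1 g0 g1; clear; lra.
Qed.

(** Hoelder with exponents q and 1 / b, then [two_point] applied to the p-th roots of F0 and F1. *)
Lemma two_point_bilinear (R : realType) (p q delta : R) : 1 <= q -> 0 <= delta <= 1 ->
  p = 1 + (q - 1) * (1 - 2 * delta) ^+ 2 ->
  let a := p^-1 in let b := 1 - q^-1 in
  forall F0 F1 G0 G1 : R, 0 <= F0 -> 0 <= F1 -> 0 <= G0 -> 0 <= G1 ->
    (((1 - delta) * F0 `^ a + delta * F1 `^ a) * G0 `^ b +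
     (delta * F0 `^ a + (1 - delta) * F1 `^ a) * G1 `^ b) / 2 <=
    ((F0 + F1) / 2) `^ a * ((G0 + G1) / 2) `^ b.
Proof.
move=> q1 d01 pE a b F0 F1 G0 G1 F0p F1p G0p G1p.
have p0 : 0 < p by rewrite pE; apply: ltr_pwDl => //; rewrite mulr_ge0 ?sqr_ge0 //; lra.
have q0 : 0 < q by lra.
have f0p : 0 <= F0 `^ a by exact: powR_ge0.
have f1p : 0 <= F1 `^ a by exact: powR_ge0.
have g0p : 0 <= G0 `^ b by exact: powR_ge0.
have g1p : 0 <= G1 `^ b by exact: powR_ge0.
have := two_point q1 d01 f0p f1p; rewrite -pE.
have -> : pmean2 p (F0 `^ a) (F1 `^ a) = ((F0 + F1) / 2) `^ a.
  by rewrite /pmean2 -!powRrM mulVf ?gt_eqF // !powRr1.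
set h0 := _ + delta * _; set h1 := _ + (1 - delta) * _ => H.
have h0p : 0 <= h0 by rewrite addr_ge0 // mulr_ge0 //; lra.
have h1p : 0 <= h1 by rewrite addr_ge0 // mulr_ge0 //; lra.
have bp : 0 <= b by rewrite /b subr_ge0 invf_le1.
apply: (@le_trans _ _ (pmean2 q h0 h1 * ((G0 + G1) / 2) `^ b)); last first.
  by rewrite ler_wpM2r ?powR_ge0.
(* For q = 1 the conjugate exponent is infinite: b = 0, and zeroth powers are 1, also at 0. *)
have [q1'|q1'] := eqVneq q 1.
  by rewrite /b q1' invr1 subrr !powRr0 !mulr1 pmean2_1.
have b0 : 0 < b by rewrite /b subr_gt0 invf_lt1 // lt_neqAle eq_sym q1'.
have iq : q^-1 + (b^-1)^-1 = 1 by rewrite invrK /b; ring.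
have ib0 : 0 < b^-1 by rewrite invr_gt0.
have i2 : (0 : R) <= 2^-1 by rewrite invr_ge0.
have := hoelder2 h0p h1p g0p g1p q0 ib0 iq.
rewrite invrK -!powRrM mulfV ?gt_eqF // !powRr1 // => /(ler_wpM2r i2) /le_trans; apply.
have S1 : 0 <= h0 `^ q + h1 `^ q by rewrite addr_ge0 ?powR_ge0.
have S2 : 0 <= G0 + G1 by rewrite addr_ge0.
rewrite /pmean2 (powRM _ S1 i2) (powRM _ S2 i2) mulrACA.
(* The factor 1/2 splits as (1/2)^(1/q) (1/2)^b, turning both Hoelder sums into means. *)
have e : q^-1 + b = 1 by rewrite /b; ring.
rewrite -powRD; last by rewrite e oner_eq0.
by rewrite e powRr1.
Qed.

Lemma noise_hypercontractive (R : realType) (p q delta : R) n (f : cube n -> R) :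
  1 <= q -> 0 <= delta <= 1 -> p = 1 + (q - 1) * (1 - 2 * delta) ^+ 2 ->
  (forall x, 0 <= f x) ->
  mean (fun x => noise_op delta f x `^ q) `^ q^-1 <= mean (fun x => f x `^ p) `^ p^-1.
Proof.
move=> q1 d01 pE f0.
have p0 : 0 < p by rewrite pE; apply: ltr_pwDl => //; rewrite mulr_ge0 ?sqr_ge0 //; lra.
have q0 : 0 < q by lra.
have T0 x : 0 <= noise_op delta f x by exact: noise_op_ge0.
set m := mean (fun x => noise_op delta f x `^ q).
have m0 : 0 <= m by apply: mean_ge0 => x; exact: powR_ge0.
have [->|mN] := eqVneq m 0; first by rewrite powR0 ?powR_ge0 // invr_eq0 gt_eqF.
have mp : 0 < m by rewrite lt_neqAle eq_sym mN.
(* Duality: the extremal test function for the L^q norm of [T f] is [(T f)^(q-1)]. *)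
have := @noise_tensorization R delta p^-1 (1 - q^-1) d01 (two_point_bilinear q1 d01 pE) n
  (fun x => f x `^ p) (fun x => noise_op delta f x `^ q)
  (fun=> powR_ge0 _ _) (fun=> powR_ge0 _ _).
rewrite (_ : mean _ = m); last first.
  apply: eq_mean => x.
  rewrite (_ : noise_op _ _ _ = noise_op delta f x); last first.
    by apply: eq_bigr => z _; rewrite -powRrM mulfV ?gt_eqF // powRr1.
  rewrite -powRrM mulrBr mulr1 divff ?gt_eqF //.
  exact: mulr_powRB1.
(* [H] reads m <= E[f^p]^(1/p) m^(1 - 1/q); cancel the positive power of m. *)
move=> H; have cp : 0 < m `^ (1 - q^-1) by exact: powR_gt0.
have e : q^-1 + (1 - q^-1) = 1 by ring.
have E : m `^ q^-1 * m `^ (1 - q^-1) = m.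
  by rewrite -powRD e; [exact: powRr1|rewrite oner_eq0].
rewrite -(ler_pM2r cp); apply: le_trans H; clearbody m.
by rewrite E.
Qed.

Lemma noise_op0 (R : realType) n (f : cube n -> R) x : noise_op 0 f x = f x.
Proof.
rewrite /noise_op (bigD1 0) //= addr0 big1 => [|z z0].
  by rewrite addr0 /noise_weight big1 ?mul1r // => i _; rewrite mxE eqxx subr0.
have [i zi] : exists i, z 0 i != 0 by apply/rV0Pn.
by rewrite /noise_weight (bigD1 i) //= (negbTE zi) !mul0r.
Qed.

(* Hoelder's inequality against the constant 1, i.e. the tensorisation at [delta = 0]. *)
Lemma mean_powR_le (R : realType) (r : R) n (f : cube n -> R) : 1 <= r ->
  (forall x, 0 <= f x) -> mean f <= mean (fun x => f x `^ r) `^ r^-1.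
Proof.
move=> r1 f0; have r0 : 0 < r by lra.
have d01 : 0 <= (0 : R) <= 1 by rewrite lexx ler01.
have rE : r = 1 + (r - 1) * (1 - 2 * 0) ^+ 2 by ring.
have := @noise_tensorization R 0 r^-1 (1 - r^-1) d01 (two_point_bilinear r1 d01 rE) n
  (fun x => f x `^ r) (fun=> 1) (fun=> powR_ge0 _ _) (fun=> ler01).
rewrite mean_cst powR1 mulr1; apply: le_trans; rewrite le_eqVlt; apply/orP; left.
apply/eqP/eq_mean => x.
by rewrite mulr1 noise_op0 -powRrM mulfV ?gt_eqF // powRr1.
Qed.

(** The preceding bound, applied to f^r with exponent s / r. *)
Lemma power_mean_le (R : realType) (r s : R) n (f : cube n -> R) : 0 < r -> r <= s ->
  (forall x, 0 <= f x) ->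
  mean (fun x => f x `^ r) `^ r^-1 <= mean (fun x => f x `^ s) `^ s^-1.
Proof.
move=> r0 rs f0; have s0 : 0 < s by exact: lt_le_trans rs.
have rs1 : 1 <= s / r by rewrite ler_pdivlMr // mul1r.
have := mean_powR_le rs1 (fun x => powR_ge0 (f x) r).
rewrite (_ : mean (fun x => _ `^ (s / r)) = mean (fun x => f x `^ s)); last first.
  by apply: eq_mean => x; rewrite -powRrM mulrC divfK ?gt_eqF.
move=> H; have ir0 : 0 <= r^-1 by rewrite invr_ge0 ltW.
have m1 : 0 <= mean (fun x => f x `^ r) by apply: mean_ge0 => x; exact: powR_ge0.
apply: le_trans (ge0_ler_powR ir0 m1 (powR_ge0 _ _) H) _.
rewrite -powRrM (_ : (s / r)^-1 / r = s^-1) //.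
by field; rewrite !gt_eqF.
Qed.

(** * Binomial point masses *)

Lemma bernoulli_ge (R : realDomainType) (x : R) n : -1 <= x -> 1 + n%:R * x <= (1 + x) ^+ n.
Proof.
move=> x1; elim: n => [|n IH]; first by rewrite mul0r addr0 expr0.
rewrite exprSr; apply: le_trans (_ : (1 + n%:R * x) * (1 + x) <= _).
  rewrite -(natr1 n).
  have : 0 <= n%:R * (x ^+ 2) by rewrite mulr_ge0 // sqr_ge0.
  by rewrite expr2; move: (n%:R : R) => m; lra.
by rewrite ler_wpM2r //; lra.
Qed.

(* Monotonicity of (1 + 1/j)^j with denominators cleared. *)
Lemma pow_succ_ratio_le (j m : nat) : (j <= m)%N ->
  (j.+1 ^ j * m ^ m <= j ^ j * m.+1 ^ m)%N.
Proof.
(* Consecutive terms: (1 + 1/k)^k <= (1 + 1/(k+1))^(k+1). With a = k + 1 this follows from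
   Bernoulli, (1 - a^-2)^k >= c := 1 - (a - 1) / a^2, and c (a + 1) = a + a^-2. *)
have step k : (k.+1 ^ k * k.+1 ^ k.+1 <= k ^ k * k.+2 ^ k.+1)%N.
  rewrite -(ler_nat rat) !natrM !natrX.
  have kp : 0 < k.+1%:R :> rat by rewrite ltr0n.
  set a : rat := k.+1%:R.
  have ek : k%:R = a - 1 :> rat by rewrite /a -(natr1 k); ring.
  have ek2 : k.+2%:R = a + 1 :> rat by rewrite /a -(natr1 k.+1).
  have a1 : 1 <= a by rewrite /a ler1n.
  rewrite ek ek2 !exprSr.
  have := @bernoulli_ge rat (- (a ^- 2)) k.
  have -> : 1 + - a ^- 2 = (a - 1) * (a + 1) / a ^+ 2 by field; lra.
  rewrite expr_div_n exprMn ek => B.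
  have {}B := B _.
  have a2 : 0 < a ^+ 2 by rewrite exprn_gt0.
  have : -1 <= - a ^- 2 by rewrite lerN2 invf_le1 //; nra.
  move/B; rewrite ler_pdivlMr ?exprn_gt0 //.
  rewrite -exprM mulnC exprM => B'.
  set c := 1 + (a - 1) * - a ^- 2 in B' *.
  have ca : 0 <= c * (a + 1) - a.
    have -> : c * (a + 1) - a = a ^- 2 by rewrite /c; field; lra.
    by rewrite invr_ge0 ltW.
  have : 0 <= ((a - 1) ^+ k * (a + 1) ^+ k - c * (a ^+ k) ^+ 2) * (a + 1).
    by apply: mulr_ge0; [rewrite subr_ge0|lra].
  have := mulr_ge0 (sqr_ge0 (a ^+ k)) ca; rewrite !expr2.
  clear B' ca; clearbody c; move: ((a - 1) ^+ k) ((a + 1) ^+ k) (a ^+ k) => X Y Z.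
  clear; lra.
elim: m => [|m IH]; first by rewrite leqn0 => /eqP ->.
rewrite leq_eqVlt => /predU1P[->|]; first by rewrite mulnC.
rewrite ltnS => /IH {}IH.
have m0 : (0 < m ^ m)%N by rewrite expn_gt0; case: (m).
rewrite -(leq_pmul2l m0).
apply: leq_trans (_ : j ^ j * (m.+1 ^ m * m.+1 ^ m.+1) <= _)%N.
  by rewrite !mulnA leq_mul2r (mulnC (m ^ m)%N) IH orbT.
by rewrite (mulnCA (m ^ m)%N) leq_mul2l step orbT.
Qed.

(** k C(2k, k)^2 / 16^k is nondecreasing: its consecutive ratio is (2k + 1)^2 / (4k (k + 1)).
    Equality holds at k = 1. *)
Lemma central_binomial_lower (k : nat) : (0 < k)%N -> (16 ^ k <= 4 * k * 'C(k.*2, k) ^ 2)%N.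
Proof.
case: k => // k _; elim: k => [//|k IH].
have E : (k.+2 * 'C(k.+2.*2, k.+2) = 2 * (k.*2 + 3) * 'C(k.+1.*2, k.+1))%N.
  rewrite doubleS binS mulnDr.
  have := mul_bin_diag k.+1.*2.+1 k.+1.
  have := mul_bin_down k.+1.*2.+1 k.+1.
  have -> : (k.+1.*2.+1 - k.+1 = k.+2)%N by lia.
  move=> <- <-; rewrite /= -mulnDl; congr (_ * _)%N; lia.
move: IH E; move: 'C(_, _) 'C(_, _) => c d.
rewrite (expnS 16 k.+1); move: (16 ^ k.+1)%N => e.
rewrite -(leq_pmul2l (ltn0Sn k.+1)) => IH E.
rewrite -!mulnn.
nia.
Qed.

Section binomial_point_mass.
Variable R : realType.

(** The probability that a binomial variable with j + k trials and mean j equals j. *)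
Let M (j k : nat) : R :=
  'C(j + k, j)%:R * (j%:R ^+ j * k%:R ^+ k) / (j + k)%:R ^+ (j + k).

Let MC j k : M j k = M k j.
Proof.
rewrite /M addnC [X in X / _]mulrC [X in _ = X / _]mulrC (mulrC (j%:R ^+ j)).
by rewrite -(@bin_sub (k + j) k) ?leq_addr // addKn.
Qed.

(** With m = j + k, the ratio of the two sides is (1 + 1/j)^j / (1 + 1/m)^m, where 0^0 = 1 covers j
    = 0. *)
Let M_step j k : M j.+1 k <= M j k.
Proof.
have pos i l : 0 < (i + l)%:R ^+ (i + l) :> R.
  by rewrite -natrX ltr0n expn_gt0; case: (i + l)%N.
rewrite /M ler_pdivrMr // mulrAC ler_pdivlMr //.
rewrite -!natrX -!natrM ler_nat addSn.
have := pow_succ_ratio_le (leq_addr k j).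
have := mul_bin_diag (j + k).+1 j; rewrite /= => E H.
rewrite (expnS j.+1) (expnS (j + k).+1).
move: E H; move: (k ^ k)%N (j.+1 ^ j)%N (j ^ j)%N (_ ^ (j + k))%N (_ ^ (j + k))%N.
move: 'C(_, _) 'C(_, _) => b c x u v y z E H.
apply: (@leq_trans ((j.+1 * b) * x * (u * z))%N); first by apply/eq_leq; ring.
rewrite -E.
apply: (@leq_trans (((j + k).+1 * c) * x * (v * y))%N); first by rewrite leq_mul2l H orbT.
by apply/eq_leq; ring.
Qed.

Let M_anti i j k : M (j + i) k <= M j k.
Proof.
elim: i => [|i IH]; first by rewrite addn0.
by rewrite addnS; apply: le_trans (M_step _ _) IH.
Qed.

Lemma central_point_mass k : (0 < k)%N ->
  1 <= 2 * Num.sqrt k%:R * ('C(k.*2, k)%:R / 4 ^+ k) :> R.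
Proof.
move=> k0; rewrite mulrA ler_pdivlMr ?exprn_gt0 // mul1r.
rewrite -ler_sqr ?nnegrE ?exprn_ge0 ?mulr_ge0 ?sqrtr_ge0 //.
have -> : (4 ^+ k) ^+ 2 = 16 ^+ k :> R by rewrite exprAC; congr (_ ^+ _); ring.
rewrite !exprMn sqr_sqrtr //.
have := central_binomial_lower k0; rewrite -(ler_nat R) !natrM !natrX.
by move/le_trans; apply; rewrite le_eqVlt; apply/orP; left; apply/eqP; ring.
Qed.

(** Raising j to k can only lower the mass, so the balanced case C(2k, k) / 4^k is the worst. *)
Let M_lower j k : (0 < k)%N -> (j <= k)%N -> 1 <= 2 * Num.sqrt (j + k)%:R * M j k.
Proof.
move=> k0 jk; apply: le_trans (central_point_mass k0) _.
have Mk : M k k = 'C(k.*2, k)%:R / 4 ^+ k.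
  have k1 : k%:R != 0 :> R by rewrite pnatr_eq0 -lt0n.
  rewrite /M addnn -exprD addnn -mulrA; congr (_ * _).
  have h : k%:R / (k.*2)%:R = 2^-1 :> R by rewrite -mul2n natrM; field.
  rewrite -expr_div_n h -mul2n exprM -exprVn; congr (_ ^+ _).
  by rewrite exprVn; congr (_^-1); ring.
have Ms : 'C(k.*2, k)%:R / 4 ^+ k <= M j k by rewrite -Mk -{1}(subnKC jk); exact: M_anti.
apply: ler_pM; last exact: Ms.
- by apply: mulr_ge0; rewrite ?sqrtr_ge0.
- by rewrite divr_ge0 // exprn_ge0.
- by rewrite ler_pM2l // ler_sqrt ?ler_nat ?leq_addl.
Qed.

Lemma binomial_mode_lower n j : (0 < n)%N -> (j <= n)%N ->
  1 <= 2 * Num.sqrt n%:R *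
    ('C(n, j)%:R * (j%:R / n%:R) ^+ j * (1 - j%:R / n%:R) ^+ (n - j)) :> R.
Proof.
move=> n0 jn.
have nR : n%:R != 0 :> R by rewrite pnatr_eq0 -lt0n.
have -> : 'C(n, j)%:R * (j%:R / n%:R) ^+ j * (1 - j%:R / n%:R) ^+ (n - j) =
    M j (n - j) :> R.
  rewrite /M subnKC //.
  have -> : 1 - j%:R / n%:R = (n - j)%:R / n%:R :> R by rewrite natrB //; field.
  rewrite !expr_div_n -[in RHS](subnKC jn) exprD subnKC //.
  by field; rewrite !expf_neq0.
case: (leqP j (n - j)) => h.
  by rewrite -{1}(subnKC jn); apply: M_lower => //; lia.
by rewrite MC -{1}(subnK jn); apply: M_lower; lia.
Qed.

(** For odd n the radius is not n / 2, so the mode estimate does not apply at rate 1/2. With n = 2k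
    + 1, the mass at k equals the central mass for 2k + 2 trials. *)
Lemma half_point_mass_lower n : (0 < n)%N ->
  1 <= 2 * Num.sqrt n%:R * ('C(n, n./2)%:R * (1 / 2) ^+ n) :> R.
Proof.
move=> n0; rewrite -{1 2 4}(odd_double_half n); case: (boolP (odd n)) => on /=.
  set k := n./2.
  have -> : 'C(1 + k.*2, k)%:R = 'C(k.+1.*2, k.+1)%:R / 2 :> R.
    rewrite doubleS binS.
    have -> : 'C(k.*2.+1, k.+1) = 'C(k.*2.+1, k).
      by rewrite -bin_sub; [congr 'C(_, _); lia|lia].
    by rewrite natrD add1n; field.
  have := @central_point_mass k.+1 isT.
  have -> : (1 / 2) ^+ (1 + k.*2) = 2 / 4 ^+ k.+1 :> R.
    have h : (1 / 2) ^+ 2 = 4^-1 :> R by rewrite expr_div_n expr1n mul1r; congr (_^-1); ring.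
    rewrite add1n exprS -mul2n exprM h exprVn exprS.
    by field; rewrite expf_neq0.
  move/le_trans; apply.
  have := ler0n R 'C(k.+1.*2, k.+1).
  move: ('C(_, _)%:R : R) => c c0.
  rewrite (_ : c / 2 * (2 / 4 ^+ k.+1) = c / 4 ^+ k.+1); last first.
    by field; rewrite expf_neq0.
  apply: ler_wpM2r; first by rewrite divr_ge0 // exprn_ge0.
  by rewrite ler_pM2l // ler_sqrt // ler_nat; lia.
rewrite add0n -mul2n exprM; have h : (1 / 2) ^+ 2 = 4^-1 :> R.
  by rewrite expr_div_n expr1n mul1r; congr (_^-1); ring.
have k0 : (0 < n./2)%N by lia.
rewrite h exprVn mul2n; apply: le_trans (central_point_mass k0) _.
apply: ler_wpM2r; first by rewrite divr_ge0 // exprn_ge0.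
by rewrite ler_pM2l // ler_sqrt // ler_nat; lia.
Qed.

End binomial_point_mass.

(** * Rounding of the radius and choice of the noise rate *)

Lemma radius_ceil (R : realType) (delta : R) n : 0 <= delta < 2^-1 ->
  delta * n%:R <= (Defs.radius delta n)%:R < delta * n%:R + 1.
Proof.
move=> /andP[d0 d1]; rewrite /Defs.radius d1.
have x0 : 0 <= delta * n%:R by rewrite mulr_ge0.
have c0 : 0 <= Num.ceil (delta * n%:R) by rewrite ceil_ge0 (lt_le_trans _ x0).
have -> : `|Num.ceil (delta * n%:R)|%N%:R = (Num.ceil (delta * n%:R))%:~R :> R.
  by rewrite -[in RHS](gez0_abs c0).
have := ceil_itv (delta * n%:R); rewrite intrD; lra.
Qed.

Lemma radius_floor (R : realType) (delta : R) n : 2^-1 <= delta ->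
  delta * n%:R - 1 < (Defs.radius delta n)%:R <= delta * n%:R.
Proof.
move=> d1; rewrite /Defs.radius ifF; last by apply/negbTE; rewrite -leNgt.
have x0 : 0 <= delta * n%:R by rewrite mulr_ge0 // (le_trans _ d1) ?invr_ge0.
have c0 : 0 <= Num.floor (delta * n%:R) by rewrite floor_ge0.
have -> : `|Num.floor (delta * n%:R)|%N%:R = (Num.floor (delta * n%:R))%:~R :> R.
  by rewrite -[in RHS](gez0_abs c0).
have := floor_itv (delta * n%:R); rewrite intrD; lra.
Qed.

Lemma radius_half (R : realType) n : Defs.radius (2^-1 : R) n = n./2.
Proof.
have := @radius_floor R 2^-1 n (lexx _).
have E : n%:R = (odd n)%:R + 2 * n./2%:R :> R.
  by rewrite -[in LHS](odd_double_half n) natrD -mul2n natrM.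
have o1 : (odd n)%:R <= 1 :> R by case: (odd n).
have o0 : 0 <= (odd n)%:R :> R by [].
move=> H.
have h1 : (Defs.radius (2^-1 : R) n)%:R < (n./2).+1%:R :> R by rewrite -natr1; lra.
have h2 : (n./2)%:R < (Defs.radius (2^-1 : R) n).+1%:R :> R by rewrite -natr1; lra.
by move: h1 h2; rewrite !ltr_nat; lia.
Qed.

(* The noise rate [e] is [radius / n] rather than [delta] itself, so that the
   binomial mass at the radius is the mode; [e] then lies between [delta] and
   [1 - delta] for large [n], except that [delta = 1/2] must be kept exact. *)
Lemma radius_noise (R : realType) (delta : R) : 0 <= delta <= 1 ->
  exists N, forall n, (N <= n)%N -> exists e : R, [/\ 0 <= e <= 1,
    (1 - 2 * e) ^+ 2 <= (1 - 2 * delta) ^+ 2, (Defs.radius delta n <= n)%N &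
    1 <= 2 * Num.sqrt n%:R *
      ('C(n, Defs.radius delta n)%:R * e ^+ Defs.radius delta n *
       (1 - e) ^+ (n - Defs.radius delta n))].
Proof.
move=> d01.
have [->|dh] := eqVneq delta 2^-1.
  exists 1%N => n n0; exists 2^-1; rewrite radius_half; split => //.
  - by lra.
  - by lia.
  have -> : 1 - 2^-1 = 1 / 2 :> R by field.
  suff -> : 'C(n, n./2)%:R * 2^-1 ^+ n./2 * (1 / 2) ^+ (n - n./2) =
      'C(n, n./2)%:R * (1 / 2) ^+ n :> R by exact: half_point_mass_lower.
  rewrite -[X in X ^+ n./2]mul1r -mulrA -exprD subnKC //; lia.
have dh' : 0 < `|1 - 2 * delta|.
  by rewrite normr_gt0 subr_eq0; apply: contra dh => /eqP h; apply/eqP; lra.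
(* This threshold gives n |1 - 2 delta| > 1. Rounding moves j towards n / 2 by less than 1, so n -
   2j changes by less than 2 and stays within n |1 - 2 delta| of 0. *)
exists (Num.bound (`|1 - 2 * delta|^-1)).+1 => n Nn.
have n0 : (0 < n)%N by exact: leq_trans Nn.
have nR : 0 < n%:R :> R by rewrite ltr0n.
have big : 1 < n%:R * `|1 - 2 * delta|.
  rewrite -ltr_pdivrMr // div1r.
  apply: lt_le_trans (archi_boundP _) _; first by rewrite invr_ge0.
  by rewrite ler_nat ltnW.
set j := Defs.radius delta n.
suff H : [/\ 0 <= n%:R - j%:R :> R &
    (n%:R - 2 * j%:R) ^+ 2 <= (n%:R * (1 - 2 * delta)) ^+ 2 :> R].
  case: H => jn H; exists (j%:R / n%:R).
  have jn' : (j <= n)%N by move: jn; rewrite subr_ge0 ler_nat.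
  split => //; last exact: binomial_mode_lower.
    by rewrite divr_ge0 //= ler_pdivrMr // mul1r ler_nat.
  have -> : 1 - 2 * (j%:R / n%:R) = (n%:R - 2 * j%:R) / n%:R :> R by field; lra.
  by rewrite expr_div_n ler_pdivrMr ?exprn_gt0 // -exprMn [_ * n%:R]mulrC.
have [d1|d1] := ltP delta 2^-1.
  have d12 : 0 <= delta < 2^-1 by lra.
  have := radius_ceil n d12; rewrite -/j.
  move: big; rewrite ger0_norm; last by lra.
  move: (j%:R : R) (n%:R : R) => x y H1 H2; split; nra.
have := @radius_floor R delta n d1; rewrite -/j.
move: big; rewrite ler0_norm; last by lra.
move: (j%:R : R) (n%:R : R) => x y H1 H2; split; nra.
Qed.

(** * Spherical means *)

Lemma noise_weight_hamming (R : realType) (e : R) n (z : cube n) :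
  noise_weight e z = e ^+ hamming z * (1 - e) ^+ (n - hamming z).
Proof.
rewrite /noise_weight big_if !prodr_const mulrC /hamming cardsE; congr (_ * _); congr (_ ^+ _).
have H := cardC [pred i : 'I_n | z 0 i != 0]; rewrite card_ord in H.
apply: (@addnI #|[pred i : 'I_n | z 0 i != 0]|).
rewrite subnKC; last exact: leq_trans (leq_addr _ _) (eq_leq H).
rewrite -[RHS]H; congr (_ + _)%N.
by apply: eq_card => i; rewrite !inE negbK.
Qed.

Lemma normc_ge0 (R : rcfType) (z : R[i]) : 0 <= Normc.normc z.
Proof. by case: z => a b; exact: sqrtr_ge0. Qed.

Lemma normc_nat (R : rcfType) m : Normc.normc (m%:R : R[i]) = m%:R.
Proof. by rewrite [LHS](@complex.normcMn R 1 m) Normc.normc1. Qed.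

Lemma normc_sum (R : rcfType) (I : Type) (r : seq I) (P : pred I) (F : I -> R[i]) :
  Normc.normc (\sum_(i <- r | P i) F i) <= \sum_(i <- r | P i) Normc.normc (F i).
Proof.
elim/big_ind2: _ => [|x1 x2 y1 y2 h1 h2|//]; first by rewrite Normc.normc0.
exact: le_trans (@complex.le_normcD R _ _) (lerD h1 h2).
Qed.

(** Only the sphere of radius j is kept in the noise average of |f|; the noise weight is constant on
    it. *)
Lemma sphere_op_le_noise (R : realType) (delta e K : R) n (f : {ffun cube n -> R[i]}) x :
  let j := Defs.radius delta n in
  0 <= e <= 1 -> (j <= n)%N -> 0 <= K ->
  1 <= K * ('C(n, j)%:R * e ^+ j * (1 - e) ^+ (n - j)) ->
  Normc.normc (sphere_op delta f x) <=
  K * noise_op e (fun y => Normc.normc (f y)) x.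
Proof.
move=> j e01 jn K0 HK; rewrite ffunE -/j Normc.normcM Normc.normcV normc_nat.
set w := e ^+ j * (1 - e) ^+ (n - j).
have w0 : 0 <= w by rewrite mulr_ge0 // exprn_ge0 //; lra.
have C0 : 0 < 'C(n, j)%:R :> R by rewrite ltr0n bin_gt0.
set s := \sum_(y | hamming y == j) Normc.normc (f (x + y)).
have s0 : 0 <= s by apply: sumr_ge0 => y _; exact: normc_ge0.
have ws : w * s <= noise_op e (fun y => Normc.normc (f y)) x.
  rewrite /noise_op (bigID (fun y => hamming y == j)) /= ler_wpDr //.
    by apply: sumr_ge0 => y _; rewrite mulr_ge0 ?normc_ge0 ?noise_weight_ge0.
  by rewrite mulr_sumr ler_sum // => y /eqP yj; rewrite noise_weight_hamming yj.
apply: le_trans (ler_wpM2l K0 ws).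
apply: (@le_trans _ _ ('C(n, j)%:R^-1 * s)).
  by apply: ler_wpM2l; [rewrite invr_ge0 ltW|exact: normc_sum].
rewrite mulrA; apply: ler_wpM2r => //.
rewrite -[_^-1]mul1r ler_pdivrMr //; move: HK; rewrite -(mulrA _ (e ^+ j)) -/w.
by rewrite -mulrA (mulrC w).
Qed.

Lemma lpnorm_ge0 (R : realType) n p (f : {ffun cube n -> R[i]}) : 0 <= lpnorm p f.
Proof.
case: p => [r||] /=; [exact: powR_ge0| |exact: lexx].
exact: bigmax_ge_id.
Qed.

(** Norms on a probability space increase with the exponent; this passes from the Bonami exponent r
    to p, including [+oo]. *)
Lemma power_mean_lpnorm (R : realType) (r : R) p n (f : {ffun cube n -> R[i]}) :
  0 < r -> (r%:E <= p)%E ->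
  mean (fun x => Normc.normc (f x) `^ r) `^ r^-1 <= lpnorm p f.
Proof.
move=> r0; case: p => [s||] /=; last by [].
  by rewrite lee_fin => rs; apply: power_mean_le => // x; exact: normc_ge0.
move=> _; set M := \big[_/_]_x _.
have M0 : 0 <= M by exact: bigmax_ge_id.
have ir0 : 0 <= r^-1 by rewrite invr_ge0 ltW.
have -> : M = (M `^ r) `^ r^-1 by rewrite -powRrM mulfV ?gt_eqF // powRr1.
apply: ge0_ler_powR => //; first by rewrite nnegrE mean_ge0 // => x; exact: powR_ge0.
  by rewrite nnegrE powR_ge0.
rewrite -(@mean_cst R n (M `^ r)); apply: le_mean => x.
apply: ge0_ler_powR; rewrite ?nnegrE ?normc_ge0 ?(ltW r0) //.
exact: (le_bigmax _ (fun x => Normc.normc (f x)) x).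
Qed.

Lemma lpnorm_sphere_op_le (R : realType) (delta e q K : R) p n (f : {ffun cube n -> R[i]}) :
  let j := Defs.radius delta n in
  1 <= q -> 0 <= e <= 1 -> ((1 + (q - 1) * (1 - 2 * e) ^+ 2)%:E <= p)%E ->
  (j <= n)%N -> 0 <= K ->
  1 <= K * ('C(n, j)%:R * e ^+ j * (1 - e) ^+ (n - j)) ->
  lpnorm q%:E (sphere_op delta f) <= K * lpnorm p f.
Proof.
move=> j q1 e01; set r := 1 + _ => rp jn K0 HK.
have q0 : 0 < q by lra.
have r0 : 0 < r by rewrite /r; apply: ltr_pwDl => //; rewrite mulr_ge0 ?sqr_ge0 //; lra.
apply: le_trans (ler_wpM2l K0 (power_mean_lpnorm f r0 rp)).
set g := fun x => Normc.normc (f x).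
have g0 x : 0 <= g x by exact: normc_ge0.
have Tg0 x : 0 <= noise_op e g x by exact: noise_op_ge0.
apply: le_trans (ler_wpM2l K0 (noise_hypercontractive q1 e01 (erefl r) g0)).
have iq0 : 0 <= q^-1 by rewrite invr_ge0 ltW.
have mp0 (h : cube n -> R) : 0 <= mean (fun x => h x `^ q).
  by apply: mean_ge0 => x; exact: powR_ge0.
have -> : K = (K `^ q) `^ q^-1 by rewrite -powRrM mulfV ?gt_eqF // powRr1.
rewrite -(powRM _ (powR_ge0 K q) (mp0 _)) -meanZ.
apply: ge0_ler_powR => //; rewrite ?nnegrE ?mp0 //.
  by apply: mean_ge0 => x; rewrite mulr_ge0 ?powR_ge0.
apply: le_mean => x; rewrite -(powRM _ K0 (Tg0 x)).
apply: ge0_ler_powR; rewrite ?nnegrE ?normc_ge0 ?(ltW q0) ?mulr_ge0 //.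
exact: sphere_op_le_noise.
Qed.

Theorem theorem1p2 (R : realType) (delta q : R) (p : \bar R)
    (hdelta : 0 <= delta <= 1) (hq : 1 <= q) (hp : (1%:E <= p)%E)
    (hpq : ((1 + (q - 1) * (1 - 2 * delta) ^+ 2)%:E <= p)%E) :
  exists C : R, \forall n \near \oo,
    (opnorm p q%:E (@sphere_op R delta n) <= (C * Num.sqrt n%:R)%:E)%E.
Proof.
have [N HN] := radius_noise hdelta.
exists 2; exists N => // n /= /HN[e [e01 ed jn mass]].
apply: ge_ereal_sup => _ [f _ <-]; rewrite lee_fin.
have K0 : 0 <= 2 * Num.sqrt n%:R :> R by rewrite mulr_ge0 ?sqrtr_ge0.
(* The rate e is at least as close to 1/2 as delta, so its Bonami exponent is no larger. *)
have rp : ((1 + (q - 1) * (1 - 2 * e) ^+ 2)%:E <= p)%E.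
  by apply: le_trans hpq; rewrite lee_fin lerD2l ler_wpM2l // subr_ge0.
have H := lpnorm_sphere_op_le f hq e01 rp jn K0 mass.
(* In the case of a zero norm the quotient is 0, as [0^-1 = 0]. *)
have := lpnorm_ge0 p f; rewrite le_eqVlt => /predU1P[<-|f0].
  by rewrite invr0 mulr0.
by rewrite ler_pdivrMr.
Qed.
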